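(* Let $\boldsymbol\beta/\boldsymbol\gamma=(\beta^{(1)}/\gamma^{(1)},\beta^{(2)}/\gamma^{(2)})$ be a pair of skew partitions, $(\boldsymbol\beta/\boldsymbol\gamma)_{swap}=(\beta^{(2)}/\gamma^{(2)},\beta^{(1)}/\gamma^{(1)})$, and $n\ge1$. The operator $\Phi$, which takes a vertex model configuration with boundary condition $\boldsymbol\beta/\boldsymbol\gamma$, performs the walks starting at every singleton red path on the top boundary and at every singleton blue path on the bottom boundary, and then swaps the colour of all traversed path segments, is a bijection from the set of configurations with boundary condition $\boldsymbol\beta/\boldsymbol\gamma$ to the set of configurations with boundary condition $(\boldsymbol\beta/\boldsymbol\gamma)_{swap}$.
   Context: **Vertex model.** Partitions have a fixed number of parts, zero parts allowed; in a skew partition $\beta/\gamma$, $\gamma$ has the same number of parts as $\beta$ and $\gamma_m\le\beta_m$. Consider a grid of square faces with $n$ rows (numbered $1,\dots,n$ from bottom to top) and columns $c=r,r+1,\dots,s$ from left to right, where $r=\min_{j,m}(\gamma^{(j)}_m-m+1)$ and $s=\max_{j,m}(\beta^{(j)}_m-m+1)$. Colour 1 is blue, colour 2 is red. A configuration assigns to every edge of the grid a subset of the two colours (the colours of the paths crossing that edge) such that at each face, for each colour, the number of incoming edges (bottom, left) carrying the colour equals the number of outgoing edges (top, right) carrying it, and this number is $0$ or $1$ (so the colours form up-right lattice paths, paths of the same colour not intersecting). Boundary condition $\boldsymbol\beta/\boldsymbol\gamma$: left and right boundary edges carry no colour; the bottom edge of column $c$ carries colour $j$ iff $c=\gamma^{(j)}_m-m+1$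 for some $m$; the top edge of column $c$ carries colour $j$ iff $c=\beta^{(j)}_m-m+1$ for some $m$. A face contains a colour if that colour crosses one of its sides. A path at a top or bottom boundary edge is a singleton if the other colour does not cross that edge. **Walks.** A walk starts at a singleton red path on the top boundary or a singleton blue path on the bottom boundary. It follows red paths backward (downward/leftward) and blue paths forward (upward/rightward). On entering a face not containing the other colour it continues through that face along the path it is following. On entering a face containing the other colour it switches to the path of the other colour by one of these rules (these cover every situation that arises): - T1: enters through the top edge along red, exits through the right edge along blue; - T2: enters through the right edge along red, exits through the top edge along blue; - T3: enters through the left edge along blue, exits through the bottom edge along red; - T4: enters through the bottom edge along blue, exits through the left edge along red. The walk ends when it reaches the boundary of the grid. Swapping the colour of the traversed path segments means: on every edge traversed by a walk along a path of some colour, that colour is replaced by the other colour. *)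

(* Defs.v *)
From HB Require Import structures.
From mathcomp Require Import all_boot all_order all_algebra.

Set Implicit Arguments.
Unset Strict Implicit.
Unset Printing Implicit Defensive.

Import Order.TTheory GRing.Theory Num.Theory.

Local Open Scope ring_scope.

(* The two partitions of a pair need not have the same number of parts. *)
Record skew_partition := SkewPartition {
  outer : seq nat;
  inner : seq nat;
  _ : sorted geq outer;
  _ : sorted geq inner;
  _ : size inner = size outer;
  _ : forall m, (nth 0 inner m <= nth 0 outer m)%N
}.

(* The first component has colour 1 (blue), the second colour 2 (red). *)
Definition skew_pair := (skew_partition * skew_partition)%type.

Definition swap (bg : skew_pair) : skew_pair := (bg.2, bg.1).

(* The columns la_m - m + 1 for m = 1, ..., size la; the sequence la is
   indexed from 0, so that m below stands for m - 1. *)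
Definition columns (la : seq nat) : seq int :=
  [seq (nth 0%N la m)%:Z - m%:Z | m <- iota 0 (size la)].

(* Minimum and maximum of a sequence; the value is 0 if it is empty. *)
Definition seq_min (p : seq int) : int := \big[Order.min/head 0 p]_(c <- p) c.
Definition seq_max (p : seq int) : int := \big[Order.max/head 0 p]_(c <- p) c.

Definition left_col (bg : skew_pair) : int :=
  seq_min (columns (inner bg.1) ++ columns (inner bg.2)).

Definition right_col (bg : skew_pair) : int :=
  seq_max (columns (outer bg.1) ++ columns (outer bg.2)).

(* Number of columns of the grid (see left_le_right). *)
Definition width (bg : skew_pair) : nat := `|right_col bg - left_col bg|%N.+1.

Notation colour := bool (only parsing).
Definition blue : colour := false.
Definition red : colour := true.
Definition other (k : colour) : colour := ~~ k.

(* The grid has n rows and w columns.  The 0-based indices (i, c) of a face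
   stand for row i + 1 and column r + c, where r is the leftmost column.
   inl (i, c) is the horizontal side at height i in column c, and
   inr (i, c) is the vertical side of row i with c faces on its left. *)
Definition face (n w : nat) := ('I_n * 'I_w)%type.
Definition edge (n w : nat) := ('I_n.+1 * 'I_w + 'I_n * 'I_w.+1)%type.

Section Grid.
Variables n w : nat.
Implicit Types (f : face n w) (e : edge n w) (k : colour).

Definition bottom f : edge n w := inl (widen_ord (leqnSn n) f.1, f.2).
Definition top f : edge n w := inl (lift ord0 f.1, f.2).
Definition left f : edge n w := inr (f.1, widen_ord (leqnSn w) f.2).
Definition right f : edge n w := inr (f.1, lift ord0 f.2).

Definition bottom_boundary (c : 'I_w) : edge n w := inl (ord0, c).
Definition top_boundary (c : 'I_w) : edge n w := inl (ord_max, c).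
Definition left_boundary (i : 'I_n) : edge n w := inr (i, ord0).
Definition right_boundary (i : 'I_n) : edge n w := inr (i, ord_max).

Definition config := {ffun edge n w -> {set colour}}.
Implicit Type x : config.

Definition conserved x : bool :=
  [forall f : face n w, forall k : colour,
     (((k \in x (bottom f)) + (k \in x (left f)))%N
        == ((k \in x (top f)) + (k \in x (right f)))%N)
     && ((k \in x (bottom f)) + (k \in x (left f)) <= 1)%N].

(* r is the leftmost column of the grid. *)
Definition has_boundary (r : int) (bg : skew_pair) x : bool :=
  [&& [forall i, (x (left_boundary i) == set0) && (x (right_boundary i) == set0)],
      [forall c : 'I_w,
         ((blue \in x (bottom_boundary c)) == (r + c%:Z \in columns (inner bg.1)))
         && ((red \in x (bottom_boundary c)) == (r + c%:Z \in columns (inner bg.2)))]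
    & [forall c : 'I_w,
         ((blue \in x (top_boundary c)) == (r + c%:Z \in columns (outer bg.1)))
         && ((red \in x (top_boundary c)) == (r + c%:Z \in columns (outer bg.2)))]].

Definition configurations (r : int) (bg : skew_pair) : {set config} :=
  [set x | conserved x && has_boundary r bg x].

Definition contains x f k : bool :=
  [|| k \in x (bottom f), k \in x (left f), k \in x (top f) | k \in x (right f)].

(* A walk visits states (e, k): it traverses the edge e along the path of
   colour k, backward if k is red and forward if k is blue. *)
Definition state := (edge n w * colour)%type.
Implicit Types s t : state.

Definition enters f s : bool :=
  s.1 \in (if s.2 == red then [:: top f; right f] else [:: bottom f; left f]).

Definition exits f s : bool :=
  s.1 \in (if s.2 == red then [:: bottom f; left f] else [:: top f; right f]).

(* The walk uses the two outgoing sides of the face when it turns from red to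
   blue, and the two incoming sides when it turns from blue to red. *)
Definition switch f s t : bool :=
  (s, t) \in [:: ((top f, red), (right f, blue));
                 ((right f, red), (top f, blue));
                 ((left f, blue), (bottom f, red));
                 ((bottom f, blue), (left f, red))].

(* A walk that has reached a boundary edge enters no further face. *)
Definition step x s t : bool :=
  [exists f : face n w,
     [&& enters f s, t.2 \in x t.1
       & if contains x f (other s.2) then switch f s t
         else exits f t && (t.2 == s.2)]].

Definition start x s : bool :=
  [exists c : 'I_w,
     ((s == (top_boundary c, red)) && (x (top_boundary c) == [set red]))
     || ((s == (bottom_boundary c, blue)) && (x (bottom_boundary c) == [set blue]))].

(* On configurations satisfying the conservation rule each state reached by a
   walk has at most one successor, so the walk from s consists of exactly the
   states reachable from s. *)
Definition traversed x e k : bool :=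
  [exists s, start x s && connect (step x) s (e, k)].

Definition Phi x : config :=
  [ffun e => [set k in x e | ~~ traversed x e k]
             :|: [set other k | k in x e & traversed x e k]].

End Grid.

Lemma seq_min_mem (p : seq int) : p != [::] ->
  seq_min p \in p /\ forall c, c \in p -> seq_min p <= c.
Proof.
move=> p0; split; last first.
  by move=> c cp; rewrite /seq_min; exact: (@ge_bigmin_seq _ _ _ _ _ c xpredT id cp).
case: p p0 => // a p _; rewrite /seq_min big_seq /=.
elim/big_ind: _ => [|b c hb hc|//]; first exact: mem_head.
by case: leP.
Qed.

Lemma seq_max_mem (p : seq int) : p != [::] ->
  seq_max p \in p /\ forall c, c \in p -> c <= seq_max p.
Proof.
move=> p0; split; last first.
  by move=> c cp; rewrite /seq_max; exact: (@le_bigmax_seq _ _ _ _ _ c xpredT id cp).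
case: p p0 => // a p _; rewrite /seq_max big_seq /=.
elim/big_ind: _ => [|b c hb hc|//]; first exact: mem_head.
by case: leP.
Qed.

Lemma seq_min_catC (p q : seq int) : seq_min (p ++ q) = seq_min (q ++ p).
Proof.
have [/nilP|pq0] := boolP (nilp (p ++ q)).
  by case: p q => [|? ?] [|? ?].
have pq : p ++ q != [::] by rewrite -size_eq0.
have qp : q ++ p != [::] by rewrite -size_eq0 size_cat addnC -size_cat.
have [h1 h2] := seq_min_mem pq; have [h3 h4] := seq_min_mem qp.
by apply/le_anti; rewrite h2 ?h4 // mem_cat orbC -mem_cat.
Qed.

Lemma seq_max_catC (p q : seq int) : seq_max (p ++ q) = seq_max (q ++ p).
Proof.
have [/nilP|pq0] := boolP (nilp (p ++ q)).
  by case: p q => [|? ?] [|? ?].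
have pq : p ++ q != [::] by rewrite -size_eq0.
have qp : q ++ p != [::] by rewrite -size_eq0 size_cat addnC -size_cat.
have [h1 h2] := seq_max_mem pq; have [h3 h4] := seq_max_mem qp.
by apply/le_anti; rewrite h2 ?h4 // mem_cat orbC -mem_cat.
Qed.

Lemma left_col_swap bg : left_col (swap bg) = left_col bg.
Proof. exact: seq_min_catC. Qed.

Lemma width_swap bg : width (swap bg) = width bg.
Proof. by rewrite /width left_col_swap /right_col seq_max_catC. Qed.

Lemma columns_inner_outer (b : skew_partition) c :
  c \in columns (inner b) -> exists2 d, d \in columns (outer b) & c <= d.
Proof.
case: b => be ga /= _ _ sz le_ga /mapP [m]; rewrite mem_iota sz => hm ->.
exists ((nth 0%N be m)%:Z - m%:Z); first by apply/mapP; exists m; rewrite ?mem_iota.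
by rewrite lerD2r lez_nat.
Qed.

Lemma left_le_right bg : left_col bg <= right_col bg.
Proof.
rewrite /left_col /right_col.
set p := columns (inner _) ++ _; set q := columns (outer _) ++ _.
have pq c : c \in p -> exists2 d, d \in q & c <= d.
  rewrite mem_cat => /orP [] /columns_inner_outer [d dq le_cd];
    by exists d; rewrite // mem_cat dq ?orbT.
have szpq : size p = size q.
  have sz (b : skew_partition) : size (inner b) = size (outer b) by case: b.
  by rewrite !size_cat !size_map !size_iota !sz.
have [p0|p0] := eqVneq p [::].
  have -> : q = [::] by apply/nilP; rewrite /nilp -szpq p0.
  by rewrite p0 /seq_min /seq_max !big_nil.
have q0 : q != [::] by rewrite -size_eq0 -szpq size_eq0.
have [/pq [d dq le_d] _] := seq_min_mem p0.
exact: le_trans le_d ((seq_max_mem q0).2 _ dq).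
Qed.

(* Main.v *)
(* A walk only ever traverses edges crossed by exactly one colour. On such
   edges the rules pair up the sides of every face in a way that depends only on
   the set of these edges: a single path is followed through the face, and when
   both colours are present the two incoming sides are paired, and so are the two
   outgoing ones. Walking red backward and blue forward orients the resulting
   disjoint paths and cycles. The paths end exactly at the singleton boundary
   edges, and one end of each is a start, so the traversed edges are those
   connected to the boundary. As Phi preserves the set of singly crossed edges,
   it is an involution, and it exchanges the colours on the boundary. *)
Require Import Defs.
From mathcomp Require Import all_boot all_order all_algebra.

Set Implicit Arguments.
Unset Strict Implicit.
Unset Printing Implicit Defensive.

(** * Sources and sinks of relations on a finite type *)

Section PartialInjection.
Variables (T : finType) (r : rel T).

Lemma connect_last (s t : T) :
  connect r s t -> s = t \/ exists2 u, connect r s u & r u t.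
Proof.
case/connectP => p; elim/last_ind: p => [_ ->|p u _]; first by left.
rewrite rcons_path last_rcons => /andP[p_path ru ->]; right.
by exists (last s p) => //; apply/connectP; exists p.
Qed.

Lemma connect_invariant (P : T -> Prop) (s t : T) :
  (forall u v, P u -> r u v -> P v) -> P s -> connect r s t -> P t.
Proof.
move=> closed Ps /connectP[p]; elim: p s Ps => [|u p IH] s Ps /=; first by move=> _ ->.
by case/andP=> su; apply: IH; apply: closed su.
Qed.

(* If every state leading to s had a predecessor, then a choice of predecessors
   would be an injective self-map of this finite set that misses s. *)
Lemma source_of_sink (V : pred T) (s : T) :
    (forall u v v', V u -> r u v -> r u v' -> v = v') ->
    (forall t, ~~ r s t) -> V s ->
  exists t, [/\ V t, connect r t s & forall u, V u -> ~~ r u t].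
Proof.
move=> r_fun s_sink Vs.
pose S := [set t | V t && connect r t s].
pose P t := odflt t [pick u | V u && r u t].
have [/existsP[t /andP[]]|] := boolP [exists t, (t \in S) && ~~ [exists u, V u && r u t]].
  rewrite inE => /andP[Vt rts] /existsPn t_source.
  by exists t; split => // u Vu; have := t_source u; rewrite Vu.
move=> /existsPn all_pred.
have PP t : t \in S -> V (P t) /\ r (P t) t.
  move=> tS; rewrite /P; case: pickP => [u /andP[]//|none].
  have := all_pred t; rewrite tS negbK => /existsP[u].
  by rewrite none.
have injP : {in S &, injective P}.
  by move=> t u /PP[VPt rt] /PP[_ ru] eP; apply: r_fun VPt rt _; rewrite eP.
have subS : P @: S \subset S :\ s.
  apply/subsetP => _ /imsetP[t tS ->]; have [VPt rPt] := PP t tS.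
  have rPs : connect r (P t) s.
    by apply: connect_trans (connect1 rPt) _; move: tS; rewrite inE => /andP[].
  rewrite !inE VPt rPs !andbT; apply/eqP => Ps.
  by move: rPt; rewrite Ps (negbTE (s_sink t)).
have sS : s \in S by rewrite inE Vs connect0.
by have := subset_leq_card subS; rewrite card_in_imset // (cardsD1 s S) sS ltnn.
Qed.

End PartialInjection.

(** * Singly crossed edges and their pairing by faces *)

Section Grid.
Variables n w : nat.
Local Notation face := (face n w).
Local Notation edge := (edge n w).
Local Notation state := (state n w).
Local Notation config := (config n w).
Implicit Types (x : config) (f : face) (e : edge) (s t : state) (k : bool).

Definition single x e := (blue \in x e) (+) (red \in x e).

(** The edge of a valid state forces its colour, so such a state may be identified with its edge. *)
Definition valid x s := (s.2 \in x s.1) && (other s.2 \notin x s.1).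

Lemma validP x s : reflect (x s.1 = [set s.2]) (valid x s).
Proof.
apply: (iffP andP) => [[s1 s2]|->]; last by rewrite !inE; case: s.2.
apply/setP => k; rewrite inE; move: s1 s2; rewrite /other.
by case: s.2; case: k => /= s1 /negbTE s2; rewrite ?s1 ?s2.
Qed.

Lemma valid_single x s : valid x s -> single x s.1.
Proof. by case: s => e []; rewrite /valid /single /= => /andP[-> /negbTE->]. Qed.

Lemma single_valid x e : single x e -> exists k, valid x (e, k).
Proof.
rewrite /single => sg; exists (red \in x e); rewrite /valid.
move: sg; rewrite /red /blue /= /other.
by case E: (true \in x e); case F: (false \in x e); rewrite //= ?E ?F.
Qed.

Lemma top_bottom f : (top f == bottom f) = false.
Proof. by apply/negbTE/eqP => -[] /esym/n_Sn. Qed.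

Lemma right_left f : (right f == left f) = false.
Proof. by apply/negbTE/eqP => -[] /esym/n_Sn. Qed.

Definition local_step x f s t : bool :=
  [&& enters f s, t.2 \in x t.1
    & if contains x f (other s.2) then switch f s t
      else exits f t && (t.2 == s.2)].

Definition inner_pairs f : seq (edge * edge) :=
  [:: (bottom f, left f); (left f, bottom f); (top f, right f); (right f, top f)].

Definition through_pairs f : seq (edge * edge) :=
  [:: (bottom f, top f); (bottom f, right f); (left f, top f); (left f, right f);
      (top f, bottom f); (top f, left f); (right f, bottom f); (right f, left f)].

(* By conservation the total number of paths entering a face is 0, 1 or 2, so
   the exclusive or holds exactly when one path crosses it. *)
Definition face_adjacent x f e e' : bool :=
  ((e, e') \in inner_pairs f)
  || (single x (bottom f) (+) single x (left f)) && ((e, e') \in through_pairs f).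

Definition adjacent x e e' : bool :=
  [&& single x e, single x e' & [exists f, face_adjacent x f e e']].

Definition on_boundary e : bool :=
  [exists c, (e == top_boundary n c) || (e == bottom_boundary n c)].

(** Unoriented counterpart of [traversed]. It depends on [x] only through [single x], hence is the
    same for [x] and [Phi x]. *)
Definition touched x e : bool :=
  [exists b, [&& on_boundary b, single x b & connect (adjacent x) b e]].

Lemma face_conserved x : conserved x -> forall f k,
  (((k \in x (bottom f)) + (k \in x (left f)))%N
     == ((k \in x (top f)) + (k \in x (right f)))%N)
  && ((k \in x (bottom f)) + (k \in x (left f)) <= 1)%N.
Proof. by move=> /forallP c f; apply/forallP. Qed.

(** * Walks inside one face *)

Lemma entersP f s : enters f s ->
  [\/ s = (top f, red), s = (right f, red), s = (bottom f, blue) | s = (left f, blue)].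
Proof.
by case: s => e []; rewrite /enters !inE => /orP[]/eqP /= ->;
  [apply: Or41 | apply: Or42 | apply: Or43 | apply: Or44].
Qed.

Lemma exitsP f s : exits f s ->
  [\/ s = (bottom f, red), s = (left f, red), s = (top f, blue) | s = (right f, blue)].
Proof.
by case: s => e []; rewrite /exits !inE => /orP[]/eqP /= ->;
  [apply: Or41 | apply: Or42 | apply: Or43 | apply: Or44].
Qed.

Lemma local_step_exits x f s t : local_step x f s t -> exits f t.
Proof.
case/and3P=> _ _; case: ifP => _; last by case/andP.
case: s t => e k [e' k']; rewrite /switch /exits !inE /=.
by case/or4P; rewrite xpair_eqE => /andP[_] /eqP[-> ->]; rewrite /= ?inE ?eqxx ?orbT.
Qed.

Lemma valid_inj x s t : valid x s -> valid x t -> s.1 = t.1 -> s = t.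
Proof.
case: s t => e k [e' k'] /andP[/= ek _] /andP[/= _ ek'] E; subst e'; congr (_, _).
by move: ek ek'; case: k; case: k' => //= ->.
Qed.

Let sides_neq f := (top_bottom f, right_left f,
  etrans (eq_sym _ _) (top_bottom f), etrans (eq_sym _ _) (right_left f)).

(* In each colour a face is crossed by at most one path; None means by none, and
   Some (i, o) tells whether it enters at the bottom and whether it exits at the top. *)
Lemma face_path x f k : conserved x -> {p : option (bool * bool) &
    ((k \in x (bottom f)) = (if p is Some (i, _) then i else false))
  * ((k \in x (left f)) = (if p is Some (i, _) then ~~ i else false))
  * ((k \in x (top f)) = (if p is Some (_, o) then o else false))
  * ((k \in x (right f)) = (if p is Some (_, o) then ~~ o else false))}%type.
Proof.
move=> /face_conserved/(_ f k) H.
exists (if (k \in x (bottom f)) || (k \in x (left f))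
        then Some (k \in x (bottom f), k \in x (top f)) else None).
by move: H; case: (k \in x (bottom f)); case: (k \in x (left f));
  case: (k \in x (top f)); case: (k \in x (right f)).
Qed.

Local Ltac face_simpl :=
  rewrite /local_step /face_adjacent /inner_pairs /through_pairs
    /valid /enters /exits /contains /switch /single /other /red /blue
    /= ?inE ?xpair_eqE /= ?sides_neq ?eqxx ?andbF ?andbT /=.

Local Ltac face_cases cons f :=
  let e := fresh "e" in
  case: (face_path f false cons) => [[[[] []]|] e]; rewrite ?e {e};
  case: (face_path f true cons) => [[[[] []]|] e]; rewrite ?e {e}.

(** When the walk turns, the other colour is absent from the side of entry, so conservation puts it
    on the side paired with it, where the followed colour cannot also be. When the walk does not
    turn, the face contains no other colour. *)
Lemma local_stepP x f s t : conserved x -> valid x s -> local_step x f s t ->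
  valid x t && face_adjacent x f s.1 t.1.
Proof.
move=> cons v st; move: v (st).
have /andP[/entersP fs _] := st; have /exitsP ft := local_step_exits st.
by case: fs => ->; case: ft => ->; face_simpl; face_cases cons f.
Qed.

(** The only singly crossed side that can be paired with [e]. The value is meaningful only if [e] is
    itself a singly crossed side of [f]. *)
Definition partner x f e :=
  if single x (bottom f) (+) single x (left f) then
    if (e == bottom f) || (e == left f)
    then if single x (top f) then top f else right f
    else if single x (bottom f) then bottom f else left f
  else if e == bottom f then left f else if e == left f then bottom f
  else if e == top f then right f else top f.

(** The conservation laws of the two colours, added and read modulo 2. *)
Lemma single_conserved x f : conserved x ->
  single x (bottom f) (+) single x (left f) = single x (top f) (+) single x (right f).
Proof. by move=> cons; rewrite /single /red /blue; face_cases cons f. Qed.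

Lemma adjacent_partner x f e e' : conserved x -> face_adjacent x f e e' ->
  single x e -> single x e' -> e' = partner x f e.
Proof.
move=> /(single_conserved f).
rewrite /face_adjacent /partner !inE !xpair_eqE => cons adj sg sg'.
move: adj cons; case/orP => [/or4P[]|/andP[bl]].
(* Two singly crossed sides of an inner pair make the parity even, for the outgoing pair by
   conservation. *)
1-4: move=> /andP[/eqP E /eqP E']; move: sg sg'; rewrite E E' => -> ->.
1-4: rewrite ?sides_neq ?eqxx //=.
1-2: by move=> ->.
(* The parity is odd here, so exactly one incoming and one outgoing side are singly crossed. *)
do 8?[case/orP]; move=> /andP[/eqP E /eqP E'] cons; subst e e'.
all: move: bl cons sg sg'; rewrite ?sides_neq ?eqxx /=.
all: by case: (single x (bottom f)); case: (single x (left f));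
  case: (single x (top f)); case: (single x (right f)).
Qed.

Lemma adjacent_inj x f e e1 e2 : conserved x -> single x e -> single x e1 ->
  single x e2 -> face_adjacent x f e e1 -> face_adjacent x f e e2 -> e1 = e2.
Proof.
move=> cons sg sg1 sg2 adj1 adj2.
have E1 := adjacent_partner cons adj1 sg sg1.
have E2 := adjacent_partner cons adj2 sg sg2.
exact: etrans E1 (esym E2).
Qed.

Lemma face_adjacent_sym x f e e' : face_adjacent x f e e' -> face_adjacent x f e' e.
Proof.
pose P (p : edge * edge) := face_adjacent x f p.2 p.1.
move=> adj; suff: P (e, e') by [].
case/orP: adj => [|/andP[sg]]; apply: (@allP _ P); rewrite /P.
  by face_simpl.
by rewrite /face_adjacent sg; face_simpl.
Qed.

Lemma local_step_fun x f s t t' : conserved x -> valid x s ->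
  local_step x f s t -> local_step x f s t' -> t = t'.
Proof.
move=> cons v st st'.
have /andP[vt adj] := local_stepP cons v st.
have /andP[vt' adj'] := local_stepP cons v st'.
apply: (valid_inj vt vt').
exact: adjacent_inj cons (valid_single v) (valid_single vt) (valid_single vt') adj adj'.
Qed.

Lemma local_step_inj x f s s' t : conserved x -> valid x s -> valid x s' ->
  local_step x f s t -> local_step x f s' t -> s = s'.
Proof.
move=> cons v v' st st'.
have /andP[vt /face_adjacent_sym adj] := local_stepP cons v st.
have /andP[_ /face_adjacent_sym adj'] := local_stepP cons v' st'.
apply: (valid_inj v v').
exact: adjacent_inj cons (valid_single vt) (valid_single v) (valid_single v') adj adj'.
Qed.

Lemma local_step_succ x f s : conserved x -> enters f s -> valid x s ->
  exists t, local_step x f s t.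
Proof.
move=> cons /entersP fs v.
suff /or4P : [|| local_step x f s (bottom f, red), local_step x f s (left f, red),
    local_step x f s (top f, blue) | local_step x f s (right f, blue)].
  by case=> st; eexists; exact: st.
by move: v; case: fs => ->; face_simpl; face_cases cons f.
Qed.

(** Each rule can be read backward, so a walk can be retraced through the face it has just left. *)
Lemma local_step_pred x f t : conserved x -> exits f t -> valid x t ->
  exists2 s, valid x s & local_step x f s t.
Proof.
move=> cons /exitsP ft v.
suff /or4P : [|| valid x (top f, red) && local_step x f (top f, red) t,
    valid x (right f, red) && local_step x f (right f, red) t,
    valid x (bottom f, blue) && local_step x f (bottom f, blue) t
  | valid x (left f, blue) && local_step x f (left f, blue) t].
  by case=> /andP[vs st]; (eexists; [exact: vs | exact: st]).
by move: v; case: ft => ->; face_simpl; face_cases cons f.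
Qed.

Lemma adjacent_side x f e e' k : face_adjacent x f e e' ->
  enters f (e, k) || exits f (e, k).
Proof.
pose P (p : edge * edge) := enters f (p.1, k) || exits f (p.1, k).
move=> adj; suff: P (e, e') by [].
case/orP: adj => [|/andP[_]]; apply: (@allP _ P); rewrite /P {P}.
  by case: k; rewrite /enters /exits /= !inE !eqxx ?orbT.
by case: k; rewrite /enters /exits /= !inE !eqxx ?orbT.
Qed.

(** The state [s] either enters or exits [f]. Its successor or predecessor there lies on a side
    paired with that of [s], and this side is unique. *)
Lemma adjacent_local_step x f s t : conserved x -> face_adjacent x f s.1 t.1 ->
  valid x s -> valid x t -> local_step x f s t || local_step x f t s.
Proof.
move=> cons adj vs vt.
have partner_eq u : valid x u -> face_adjacent x f s.1 u.1 -> u = t.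
  move=> vu adj'; apply: (valid_inj vu vt).
  exact: adjacent_inj cons (valid_single vs) (valid_single vu) (valid_single vt) adj' adj.
have := adjacent_side s.2 adj; rewrite -surjective_pairing => /orP[fs|fs].
  have [u su] := local_step_succ cons fs vs.
  by have /andP[vu /(partner_eq _ vu) <-] := local_stepP cons vs su; rewrite su.
have [u vu us] := local_step_pred cons fs vs.
have /andP[_ /face_adjacent_sym] := local_stepP cons vu us.
by move/(partner_eq _ vu) <-; rewrite us orbT.
Qed.

(** Here [T] abstracts [touched x]. In odd parity a single path crosses the face, and it is
    recoloured on both of its sides or on neither. In even parity, swapping an inner pair makes its
    two sides trade their different colours, so the count of each colour is kept. *)
Lemma swap_conserved x (T : edge -> bool) f k : conserved x ->
    (forall e e', face_adjacent x f e e' -> single x e -> single x e' -> T e = T e') ->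
    (forall e, T e -> single x e) ->
  let y e := if T e then other k \in x e else k \in x e in
  ((y (bottom f) + y (left f))%N == (y (top f) + y (right f))%N)
  && (y (bottom f) + y (left f) <= 1)%N.
Proof.
move=> cons Tadj Tsingle.
(* Boolean forms of the hypotheses, instantiated below at the sides of [f] so that the case analysis
   can compute. *)
have T' e e' : [&& face_adjacent x f e e', single x e & single x e'] ==> (T e == T e').
  by apply/implyP => /and3P[adj sg sg']; rewrite (Tadj _ _ adj).
have S' e : T e ==> single x e by apply/implyP/Tsingle.
move: (S' (bottom f)) (S' (left f)) (S' (top f)) (S' (right f)).
move: (T' (bottom f) (left f)) (T' (top f) (right f)) (T' (bottom f) (top f)).
move: (T' (bottom f) (right f)) (T' (left f) (top f)) (T' (left f) (right f)).
move=> {T' S' Tadj Tsingle} /=.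
case: k; face_simpl; face_cases cons f; rewrite ?implybT ?implybF ?eqb_id ?eqbF_neg //=.
all: by case: (T (bottom f)); case: (T (left f)); case: (T (top f)); case: (T (right f)).
Qed.

(** * Geometry of the grid and its boundary *)

Lemma widen_ord_or_max m (i : 'I_m.+1) : i = ord_max \/ exists j, i = widen_ord (leqnSn m) j.
Proof.
case: (ltnP i m) => [lt_im|le_mi]; last by left; apply/val_inj/anti_leq; rewrite -ltnS ltn_ord.
by right; exists (Ordinal lt_im); apply: val_inj.
Qed.

Lemma lift_ord_or_0 m (i : 'I_m.+1) : i = ord0 \/ exists j, i = lift ord0 j.
Proof. by case: (unliftP ord0 i) => [j ->|->]; [right; exists j | left]. Qed.

Lemma bottom_inj : injective (@bottom n w).
Proof. by move=> [i c] [i' c'] [] /= E ->; congr (_, _); apply: val_inj. Qed.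

Lemma left_inj : injective (@left n w).
Proof. by move=> [i c] [i' c'] [] /= -> E; congr (_, _); apply: val_inj. Qed.

Lemma top_inj : injective (@top n w).
Proof. by move=> [i c] [i' c'] [] /= E ->; congr (_, _); apply: val_inj. Qed.

Lemma right_inj : injective (@right n w).
Proof. by move=> [i c] [i' c'] [] /= -> E; congr (_, _); apply: val_inj. Qed.

Lemma enters_inj f f' s : enters f s -> enters f' s -> f = f'.
Proof.
by move=> /entersP[]-> /entersP[] // /(congr1 fst) /= E;
  first [exact: top_inj E | exact: right_inj E | exact: bottom_inj E | exact: left_inj E].
Qed.

Lemma exits_inj f f' s : exits f s -> exits f' s -> f = f'.
Proof.
by move=> /exitsP[]-> /exitsP[] // /(congr1 fst) /= E;
  first [exact: top_inj E | exact: right_inj E | exact: bottom_inj E | exact: left_inj E].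
Qed.

Lemma top_boundary_bottom c f : top_boundary n c <> bottom f.
Proof. by case=> E _; have := ltn_ord f.1; rewrite -E ltnn. Qed.

Lemma start_valid x s : start x s -> valid x s.
Proof. by case/existsP => c /orP[] /andP[/eqP-> /eqP E]; apply/validP. Qed.

Lemma start_not_exits x s f : start x s -> ~~ exits f s.
Proof.
case/existsP => c /orP[] /andP[/eqP-> _]; apply/negP => /exitsP[] //.
by move/(congr1 fst)/top_boundary_bottom.
Qed.

(** Red at the top and blue at the bottom lead into the grid; the opposite colours lead out of
    it. *)
Lemma boundary_start_or_sink x b k : on_boundary b -> valid x (b, k) ->
  start x (b, k) \/ forall f, ~~ enters f (b, k).
Proof.
case/existsP => c /orP[] /eqP-> v; case: k v => v.
- by left; apply/existsP; exists c; rewrite eqxx (validP _ _ v) eqxx.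
- right=> f; apply/negP => /entersP[] //.
  by move/(congr1 fst)/top_boundary_bottom.
- by right=> f; apply/negP => /entersP[].
- by left; apply/existsP; exists c; rewrite orbC eqxx (validP _ _ v) eqxx.
Qed.

Definition empty_sides x :=
  [forall i, (x (left_boundary w i) == set0) && (x (right_boundary w i) == set0)].

Lemma start_or_exits x s : empty_sides x -> valid x s ->
  start x s \/ exists f, exits f s.
Proof.
move=> /forallP sides; case: s => [[[i c]|[i c]] []] v.
(* Red exits a face at its bottom or left, blue at its top or right. The edges missed are the top
   boundary for red and the bottom boundary for blue, where walks start, and side boundaries, which
   are empty. *)
- case: (widen_ord_or_max i) v => [->|[j ->]] v.
    by left; apply/existsP; exists c; rewrite eqxx (validP _ _ v) eqxx.
  by right; exists (j, c); rewrite /exits !inE eqxx.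
- case: (lift_ord_or_0 i) v => [->|[j ->]] v.
    by left; apply/existsP; exists c; rewrite orbC eqxx (validP _ _ v) eqxx.
  by right; exists (j, c); rewrite /exits !inE eqxx.
- case: (widen_ord_or_max c) v => [->|[j ->]] v.
    by have /andP[_ /eqP E] := sides i; move: v; rewrite /valid /= E inE.
  by right; exists (i, j); rewrite /exits !inE eqxx orbT.
- case: (lift_ord_or_0 c) v => [->|[j ->]] v.
    by have /andP[/eqP E _] := sides i; move: v; rewrite /valid /= E inE.
  by right; exists (i, j); rewrite /exits !inE eqxx orbT.
Qed.

(** * Walks across the whole grid *)

Lemma stepP x s t : reflect (exists f, local_step x f s t) (step x s t).
Proof. exact: existsP. Qed.

Lemma step_fun x s t t' : conserved x -> valid x s ->
  step x s t -> step x s t' -> t = t'.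
Proof.
move=> cons v /stepP[f st] /stepP[f' st'].
have /andP[fs _] := st; have /andP[fs' _] := st'.
by apply: local_step_fun cons v st _; rewrite (enters_inj fs fs').
Qed.

Lemma step_inj x s s' t : conserved x -> valid x s -> valid x s' ->
  step x s t -> step x s' t -> s = s'.
Proof.
move=> cons v v' /stepP[f st] /stepP[f' st'].
have ft := local_step_exits st; have ft' := local_step_exits st'.
by apply: local_step_inj cons v v' st _; rewrite (exits_inj ft ft').
Qed.

Lemma step_adjacent x s t : conserved x -> valid x s -> step x s t ->
  valid x t /\ adjacent x s.1 t.1.
Proof.
move=> cons v /stepP[f st]; have /andP[vt adj] := local_stepP cons v st.
split=> //; rewrite /adjacent !valid_single //; apply/existsP; by exists f.
Qed.

Lemma on_boundary_start x s : start x s -> on_boundary s.1.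
Proof.
by case/existsP => c /orP[] /andP[/eqP-> _]; apply/existsP; exists c; rewrite eqxx ?orbT.
Qed.

Section Walks.
Variable x : config.
Hypotheses (cons : conserved x) (sides : empty_sides x).

Definition reached s := [exists s0, start x s0 && connect (step x) s0 s].

Lemma reached_touched s : reached s -> valid x s && touched x s.1.
Proof.
case/existsP => s0 /andP[st]; have v0 := start_valid st.
apply: (connect_invariant (P := fun s => valid x s && touched x s.1)).
  move=> u v /andP[vu /existsP[b /and3P[bb sb bu]]] uv.
  have [vv adj] := step_adjacent cons vu uv.
  rewrite vv; apply/existsP; exists b; rewrite bb sb.
  exact: connect_trans bu (connect1 adj).
rewrite v0; apply/existsP; exists s0.1.
by rewrite (on_boundary_start st) valid_single // connect0.
Qed.

Lemma reached_step s t : reached s -> step x s t -> reached t.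
Proof.
case/existsP => s0 /andP[st st_s] st'; apply/existsP; exists s0.
by rewrite st (connect_trans st_s) ?connect1.
Qed.

(** A start has no predecessor, and any other reached state has a unique valid one, which the walk
    must have visited. *)
Lemma reached_step_back s t : reached t -> valid x s -> step x s t -> reached s.
Proof.
case/existsP => s0 /andP[s0_start s0t] vs st.
case: (connect_last s0t) => [E|[u s0u ut]].
  have /stepP[f /local_step_exits] := st.
  by rewrite -E (negbTE (start_not_exits f s0_start)).
have ru : reached u by apply/existsP; exists s0; rewrite s0_start.
have /andP[vu _] := reached_touched ru.
by rewrite (step_inj cons vs vu st ut).
Qed.

(** If the edge is where a walk ends, tracing back from it leads to a state without valid
    predecessor, which can only be a start. *)
Lemma boundary_reached b k : on_boundary b -> valid x (b, k) -> reached (b, k).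
Proof.
move=> bb v; case: (boundary_start_or_sink bb v) => [st|sink].
  by apply/existsP; exists (b, k); rewrite st connect0.
have no_step t : ~~ step x (b, k) t.
  by apply/negP => /stepP[f /andP[]]; rewrite (negbTE (sink f)).
have step_funV s t t' : valid x s -> step x s t -> step x s t' -> t = t'.
  exact: step_fun.
have [t [vt tb source]] := source_of_sink step_funV no_step v.
case: (start_or_exits sides vt) => [st|[f ft]].
  by apply/existsP; exists t; rewrite st.
have [u vu ut] := local_step_pred cons ft vt.
by have /negP[] := source u vu; apply/stepP; exists f.
Qed.

Lemma touched_single e : touched x e -> single x e.
Proof.
case/existsP => b /and3P[_ sb].
by apply: (connect_invariant (P := single x)) sb => u v _ /and3P[].
Qed.

Lemma touched_reached e k : touched x e -> valid x (e, k) -> reached (e, k).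
Proof.
case/existsP => b /and3P[bb _ be].
pose P e := forall k, valid x (e, k) -> reached (e, k).
apply: (connect_invariant (P := P) _ _ be) k; last by move=> k; apply: boundary_reached.
move=> {be} {}e e' IH /and3P[sg _ /existsP[f adj]] k' v'.
have [k v] := single_valid sg.
(* Adjacency does not tell the direction of the walk, so both are treated. *)
have /orP[st|st] := adjacent_local_step cons (s := (e, k)) (t := (e', k')) adj v v'.
  by apply: reached_step (IH k v) _; apply/stepP; exists f.
by apply: reached_step_back (IH k v) v' _; apply/stepP; exists f.
Qed.

Lemma traversedE e k : traversed x e k = (k \in x e) && touched x e.
Proof.
apply/idP/andP => [/reached_touched /andP[/andP[-> _] ->] //|[ke te]].
apply: touched_reached => //; apply/validP => /=.
have [j /validP /= E] := single_valid (touched_single te).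
by move: ke; rewrite E inE => /eqP ->.
Qed.

Lemma in_Phi e k : (k \in Phi x e) = if touched x e then other k \in x e else k \in x e.
Proof.
have otherK : involutive other by exact: negbK.
(* Writing [k] as [other (other k)] turns membership in the image under [other] into membership of
   [other k]. *)
rewrite ffunE !inE -{3}(otherK k) mem_imset; last exact: inv_inj.
rewrite inE !traversedE /=.
by case: (touched x e); case: (k \in x e); case: (other k \in x e).
Qed.

Lemma single_Phi e : single (Phi x) e = single x e.
Proof. by rewrite /single !in_Phi /other /=; case: ifP => // _; rewrite addbC. Qed.

Lemma touched_adjacent f e e' : face_adjacent x f e e' -> single x e -> single x e' ->
  touched x e = touched x e'.
Proof.
suff imp e1 e2 : face_adjacent x f e1 e2 -> single x e1 -> single x e2 ->
    touched x e1 -> touched x e2.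
  by move=> adj s1 s2; apply/idP/idP; apply: imp => //; apply: face_adjacent_sym.
move=> adj s1 s2 /existsP[b /and3P[bb sb b1]]; apply/existsP; exists b.
rewrite bb sb (connect_trans b1) // connect1 // /adjacent s1 s2.
by apply/existsP; exists f.
Qed.

Lemma Phi_conserved : conserved (Phi x).
Proof.
apply/forallP => f; apply/forallP => k; rewrite !in_Phi.
exact: swap_conserved cons (@touched_adjacent f) touched_single.
Qed.

Lemma empty_sides_Phi : empty_sides (Phi x).
Proof.
have empty e : x e = set0 -> Phi x e = set0.
  by move=> E; apply/setP => k; rewrite in_Phi E !inE if_same.
apply/forallP => i; have /andP[/eqP l /eqP r] := forallP sides i.
by rewrite !empty ?eqxx.
Qed.

Lemma touched_Phi e : touched (Phi x) e = touched x e.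
Proof.
rewrite /touched; apply: eq_existsb => b; rewrite single_Phi.
congr [&& _, _ & _]; apply: eq_connect => e1 e2.
rewrite /adjacent !single_Phi; congr [&& _, _ & _]; apply: eq_existsb => f.
by rewrite /face_adjacent !single_Phi.
Qed.

(** A singly crossed boundary edge is touched by the trivial path. Any other carries both colours or
    none, so exchanging them changes nothing. *)
Lemma in_Phi_boundary b k : on_boundary b -> (k \in Phi x b) = (other k \in x b).
Proof.
move=> bb; rewrite in_Phi; case: ifPn => //; apply: contraNeq => neq.
apply/existsP; exists b; rewrite bb connect0 andbT.
by move: neq; rewrite /single /red /blue /other; case: k => /=;
  case: (true \in x b); case: (false \in x b).
Qed.

End Walks.

(** * The involution and its effect on the boundary *)

Lemma PhiK x : conserved x -> empty_sides x -> Phi (Phi x) = x.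
Proof.
move=> cons sides; apply/ffunP => e; apply/setP => k.
rewrite (in_Phi (Phi_conserved cons sides) (empty_sides_Phi cons sides)).
rewrite (touched_Phi cons sides) !(in_Phi cons sides) /other negbK.
by case: (touched x e).
Qed.

Lemma Phi_configurations r bg x : x \in configurations n w r bg ->
  Phi x \in configurations n w r (swap bg).
Proof.
rewrite !inE => /andP[cons /and3P[sides /forallP bot /forallP top]].
have bottomP c : on_boundary (bottom_boundary n c).
  by apply/existsP; exists c; rewrite eqxx orbT.
have topP c : on_boundary (top_boundary n c) by apply/existsP; exists c; rewrite eqxx.
rewrite (Phi_conserved cons sides) /=; apply/and3P; split.
- exact: (empty_sides_Phi cons sides).
(* [andbC] exchanges the blue and red conditions, as [swap] does. *)
- by apply/forallP => c; rewrite !in_Phi_boundary // andbC; exact: bot.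
- by apply/forallP => c; rewrite !in_Phi_boundary // andbC; exact: top.
Qed.

End Grid.

(* The grid of swap bg is that of bg (left_col_swap, width_swap). *)
Theorem proposition3p5 (bg : skew_pair) (n : nat) (hn : (0 < n)%N) :
  {in configurations n (width bg) (left_col bg) bg &, injective (@Phi n (width bg))}
  /\ [set Phi x | x in configurations n (width bg) (left_col bg) bg]
     = configurations n (width bg) (left_col bg) (swap bg).
Proof.
(* The boundary [bg'] varies over the fixed grid of [bg], to cover both [bg] and [swap bg]. *)
have PhiK_in (bg' : skew_pair) : {in configurations n (width bg) (left_col bg) bg',
    cancel (@Phi n (width bg)) (@Phi n (width bg))}.
  by move=> x; rewrite inE => /andP[cons /and3P[sides _ _]]; apply: PhiK.
split; first exact: can_in_inj (PhiK_in bg).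
apply/setP => y; apply/imsetP/idP => [[x xbg ->]|ybg]; first exact: Phi_configurations.
exists (Phi y); last by rewrite (PhiK_in _ _ ybg).
have swapK : swap (swap bg) = bg by rewrite /swap -surjective_pairing.
by have := Phi_configurations ybg; rewrite swapK.
Qed.
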